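(* For real $p\neq0$ and a number $\alpha\in[0,1]$ (with $\alpha\in(0,1)$ if $p<0$), put $$R:=\frac{2\alpha^{p/2}(1-\alpha)^{p/2}}{\alpha^p+(1-\alpha)^p}.$$ (1) For all such numbers $\alpha$, the inequality $$1\le\left(1+R^{2/p}\right)^{p-1}\left(\alpha^p+(1-\alpha)^p\right)\qquad( * )$$ is valid for all $p\in(0,1]\cup[2,\infty)$, and the reverse inequality ($\ge$ in place of $\le$ in $( * )$) is valid for all $p\in(-\infty,0)\cup(1,2)$. (2) Consider, for a real exponent $q$, the inequality $$1\le\left(1+R^{q}\right)^{p-1}\left(\alpha^p+(1-\alpha)^p\right).\qquad( ** )$$ For $p>2$ (resp. for $p\in(0,1)$), inequality $( ** )$ is false if $q>2/p$ (resp. if $q<2/p$). For $p<0$ (resp. for $p\in[1,2]$), the reverse of $( ** )$ is false if $q>2/p$ (resp. if $q<2/p$). (3) For $p>0$, $p\neq1,2$, there is equality in $( * )$ if and only if $\alpha\in\{0,1/2,1\}$. For $p<0$, there is equality in $( * )$ if and only if $\alpha=1/2$.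
   Context: Here $\alpha$, $p$, $q$ are real numbers. In part (2), ''false'' means that the inequality does not hold for all admissible $\alpha$.
   Formalization: In the last clause of part (2) the range p∈[1,2] is replaced by p∈(1,2]: at p=1 the right side of ( ** ) equals 1 for every q, so the reverse inequality holds with equality and is not false. *)

(* Defs.v *)
From mathcomp Require Import all_boot all_order all_algebra.
From mathcomp Require Import reals exp.
Set Implicit Arguments.
Unset Strict Implicit.
Unset Printing Implicit Defensive.
Import Order.TTheory GRing.Theory Num.Theory.
Local Open Scope ring_scope.

(* Real powers are [powR]: on a zero base, 0 `^ x = 0 for x != 0 and
   0 `^ 0 = 1.  For p > 0 this gives 0^p = 0^(p/2) = 0^(2/p) = 0, as needed at
   a = 0 and a = 1; for p < 0 those endpoints are not admissible. *)

Definition admissible (R : realType) (p a : R) : Prop :=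
  0 <= a <= 1 /\ (p < 0 -> 0 < a < 1).

Definition power_sum (R : realType) (p a : R) : R :=
  a `^ p + (1 - a) `^ p.

Definition ratioR (R : realType) (p a : R) : R :=
  2 * a `^ (p / 2) * (1 - a) `^ (p / 2) / power_sum p a.

Definition rhs (R : realType) (p q a : R) : R :=
  (1 + ratioR p a `^ q) `^ (p - 1) * power_sum p a.

(* Main.v *)
Require Import Defs.
From mathcomp Require Import all_boot all_order all_algebra.
From mathcomp Require Import reals exp.
From mathcomp Require Import boolp classical_sets topology normedtype sequences.
From mathcomp Require Import derive realfun.
From mathcomp Require Import ring lra.
Import Order.TTheory GRing.Theory Num.Theory.
Import numFieldNormedType.Exports.
Local Open Scope ring_scope.

(* Write a = e^t / (2 cosh t), so that 1 - a = e^-t / (2 cosh t) and R = 1 / cosh (p t).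
   With s = ln (cosh (p t)) / p the logarithm of the right-hand side of the inequality
   becomes G(t) = s + (p - 1) ln cosh s - p ln cosh t, an even function of t which
   vanishes at 0 and, for p > 0, at infinity.

   G' has the sign of (p - 1) (p x phi + phi - psi), where x = e^(2s),
   phi = sinh ((p - 1) t) / (p - 1) and psi = sinh ((p + 1) t).  Dividing by x phi > 0
   gives a function which tends to 0 at 0 and whose derivative is a positive multiple
   of the discriminant
     M(t) = - sinh ((3p - 2) t) + (p - 1)^2 sinh ((p + 2) t)
            - 2 (p - 2) sinh (p t) - (p^2 - 2) sinh ((p - 2) t).
   A Descartes-type argument, removing one frequency k at a time with the operator
   M'' - k^2 M, shows that M changes sign at most once on t > 0 (from + to - if p > 2,
   from - to + if 0 < p < 2, p != 1) and is positive if p < 0.  The pattern "at most one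
   sign change, in this direction" passes to a primitive vanishing at 0, hence to G',
   and then G(0) = G(oo) = 0 fixes the sign of G.

   For an exponent q the logarithm of the right-hand side has second derivative
   p (p - 1) (2 - p q) / 2 at t = 0, so the inequality fails near a = 1/2. *)

(* A plain predicate with both the point and the derivative in R: the terms
   computed by [derive_tac] then live in the ring R itself, not in R seen as a
   normed module over itself, and [ring] and [field] apply to them. *)
Definition has_deriv {R : realType} (f : R -> R) (t d : R) : Prop :=
  is_derive t 1 f d.

(** * Rules for derivatives of real functions *)

Section Derivatives.
Context {R : realType}.
Implicit Types (f g : R -> R) (a b t c d k : R).

Lemma has_deriv_eq f t c d : has_deriv f t c -> c = d -> has_deriv f t d.
Proof. by move=> df <-. Qed.

Lemma has_deriv_cst k t : has_deriv (fun _ => k) t 0.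
Proof. exact: is_derive_cst. Qed.

Lemma has_deriv_id t : has_deriv (fun x => x) t 1.
Proof. exact: is_derive_id. Qed.

Lemma has_derivD f g t c d : has_deriv f t c -> has_deriv g t d ->
  has_deriv (fun x => f x + g x) t (c + d).
Proof. by move=> df dg; exact: (is_deriveD df dg). Qed.

Lemma has_derivN f t c : has_deriv f t c -> has_deriv (fun x => - f x) t (- c).
Proof. by move=> df; exact: (is_deriveN df). Qed.

Lemma has_derivM f g t c d : has_deriv f t c -> has_deriv g t d ->
  has_deriv (fun x => f x * g x) t (c * g t + f t * d).
Proof.
move=> df dg; apply: (is_derive_eq (is_deriveM df dg)).
by rewrite /GRing.scale/=; ring.
Qed.

Lemma has_derivV f t c : f t != 0 -> has_deriv f t c ->
  has_deriv (fun x => (f x)^-1) t (- c / f t ^+ 2).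
Proof.
move=> f0 df; apply: (is_derive_eq (is_deriveV f0 df)).
by rewrite /GRing.scale/=; ring.
Qed.

Lemma has_deriv_expR f t c : has_deriv f t c ->
  has_deriv (fun x => expR (f x)) t (expR (f t) * c).
Proof. by move=> df; exact: (is_derive1_comp (is_derive_expR _) df). Qed.

Lemma has_deriv_ln f t c : 0 < f t -> has_deriv f t c ->
  has_deriv (fun x => ln (f x)) t (c / f t).
Proof.
move=> f0 df; apply: (is_derive_eq (is_derive1_comp (is_derive1_ln f0) df)).
exact: mulrC.
Qed.

Lemma has_deriv_cts f t d : has_deriv f t d -> {for t, continuous f}.
Proof.
by move=> [df _]; apply: differentiable_continuous; exact/derivable1_diffP.
Qed.

Lemma has_deriv_mvt f f1 a b : a < b ->
  (forall t, a <= t <= b -> has_deriv f t (f1 t)) ->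
  exists2 c, a < c < b & f b - f a = f1 c * (b - a).
Proof.
move=> ab df; have [||c] := @MVT R f f1 a b ab.
- by move=> t; rewrite in_itv/= => /andP[at_ tb]; apply: df; rewrite !ltW.
- apply: continuous_in_subspaceT => t; rewrite inE/= in_itv/= => /df.
  exact: has_deriv_cts.
- by rewrite in_itv/= => ? ?; exists c.
Qed.

(** By Carathéodory's form of the derivative, f t = q t * t with q continuous at 0 and q 0 = k, so q
    stays positive near 0. *)
Lemma has_deriv_pos_right f k : f 0 = 0 -> has_deriv f 0 k -> 0 < k ->
  exists2 d, 0 < d & forall t, 0 < t < d -> 0 < f t.
Proof.
move=> f0 /is_derive1_caratheodory[q [fE cq qk]] k0.
have q0 : 0 < q 0 by rewrite qk.
have : nbhs (0 : R) [set z | 0 < q z]%classic by exact: (cvgr_gt _ cq).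
move=> /nbhs_ballP[d /= d0 near_q].
exists d => // t /andP[t0 td]; have := fE t; rewrite f0 !subr0 => ->.
apply: mulr_gt0 => //; apply: near_q.
by rewrite /ball/= sub0r normrN gtr0_norm.
Qed.

End Derivatives.

(** [eassumption] comes first, so that a derivative already in the context is used as it stands
    instead of being unfolded further. *)
Ltac derive_step :=
  first [ eassumption
        | refine (has_deriv_cst _ _)
        | refine (has_deriv_id _)
        | refine (has_derivD _ _ _ _ _ _ _)
        | refine (has_derivN _ _ _ _)
        | refine (has_derivM _ _ _ _ _ _ _)
        | refine (has_derivV _ _ _ _ _)
        | refine (has_deriv_expR _ _ _ _)
        | refine (has_deriv_ln _ _ _ _ _) ].

(* Leaves the side conditions of inverses and logarithms, and the equation
   between the computed derivative and the announced one. *)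
Ltac derive_tac := refine (has_deriv_eq _ _ _ _ _ _); [repeat derive_step|]; cbv beta.

(** * Sign changes of functions, their primitives and quotients *)

Section SignPatterns.
Context {R : realType}.
Implicit Types (f g h N D e : R -> R) (a b t u v : R).

(** This encodes at most one sign change on t > 0, from + to -. The strict conclusion rules out a
    second zero. The opposite pattern is expressed through - g. *)
Definition single_drop g :=
  forall u v, 0 < u -> u < v -> g u <= 0 -> g v < 0.

(** Starting from g 0 >= 0, g can become nonpositive at u only if g1 is nonpositive somewhere before
    u. From there on g1 is negative, so g decreases strictly beyond u. *)
Lemma single_drop_primitive g g1 : (forall t, 0 <= t -> has_deriv g t (g1 t)) ->
  0 <= g 0 -> single_drop g1 -> single_drop g.
Proof.
move=> dg g0 drop1 u v u0 uv gu.
have [|c /andP[c0 cu] E] := has_deriv_mvt g g1 0 u u0.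
  by move=> t /andP[t0 _]; exact: dg.
have g1c : g1 c <= 0 by rewrite -(pmulr_lle0 _ u0); lra.
have [|d /andP[ud dv] E'] := has_deriv_mvt g g1 u v uv.
  by move=> t /andP[ut _]; apply: dg; lra.
have : g1 d * (v - u) < 0 by rewrite pmulr_llt0 ?subr_gt0// (drop1 c)//; lra.
lra.
Qed.

Lemma pos_primitive g g1 : (forall t, 0 <= t -> has_deriv g t (g1 t)) ->
  0 <= g 0 -> (forall t, 0 < t -> 0 < g1 t) -> forall t, 0 < t -> 0 < g t.
Proof.
move=> dg g0 g1_gt0 t t0.
have [|c /andP[c0 cu] E] := has_deriv_mvt g g1 0 t t0.
  by move=> x /andP[x0 _]; exact: dg.
have : 0 < g1 c * (t - 0) by rewrite mulr_gt0 ?g1_gt0// subr0.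
lra.
Qed.

Lemma single_drop_pmul f g h : (forall t, 0 < t -> 0 < h t) ->
  (forall t, 0 < t -> g t = h t * f t) -> single_drop f -> single_drop g.
Proof.
move=> h0 gE drop u v u0 uv; have v0 : 0 < v by lra.
rewrite !gE// pmulr_rle0 ?h0// pmulr_rlt0 ?h0//; exact: drop.
Qed.

(* The hypotheses at 0 say that N / D tends to 0 there. *)
Lemma quotient_crossing N D e : N 0 = 0 -> D 0 = 0 ->
  has_deriv N 0 0 -> has_deriv D 0 1 ->
  (forall t, 0 < t -> 0 < D t) ->
  (forall t, 0 < t -> has_deriv (fun x => N x / D x) t (e t)) ->
  forall u, 0 < u -> N u <= 0 -> exists2 c, 0 < c < u & e c <= 0.
Proof.
move=> N0 D0 dN dD Dpos dh u u0 Nu.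
have hu : N u / D u <= 0 by rewrite pmulr_lle0 ?invr_gt0 ?Dpos.
have mvt a b : 0 < a -> a < b -> N b / D b <= N a / D a ->
    exists2 c, a < c < b & e c <= 0.
  move=> a0 ab hab; have [|c acb E] := has_deriv_mvt (fun x => N x / D x) e a b ab.
    by move=> t /andP[at_ _]; apply: dh; lra.
  by exists c => //; rewrite -(@pmulr_lle0 _ (b - a)) ?subr_gt0// -E; lra.
have u2 : 0 < u / 2 by lra.
(* The quotient is 0 / 0 at 0, so the mean value theorem is applied away from 0: on [u / 2, u] if N
   / D is nonnegative at u / 2. *)
have [h2|h2] := leP 0 (N (u / 2) / D (u / 2)).
  have [||c /andP[? ?] ec] := mvt (u / 2) u u2; [lra|lra|].
  by exists c => //; apply/andP; split; lra.
(* Here r < 0, and N - r D has slope - r > 0 at 0. Hence N / D exceeds r at some a near 0, and the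
   mean value theorem is applied on [a, u / 2]. *)
set r := N (u / 2) / D (u / 2) in h2 *.
have [|||d d0 pos] := has_deriv_pos_right (fun x => N x - r * D x) (- r).
- by rewrite N0 D0; ring.
- by derive_tac; ring.
- lra.
have [a [a0 ad au]] : exists a, [/\ 0 < a, a < d & a < u / 2].
  exists (Order.min d (u / 2) / 2); split.
  - by rewrite divr_gt0// lt_min d0 u2.
  - have : Order.min d (u / 2) <= d by rewrite ge_min lexx.
    by lra.
  - have : Order.min d (u / 2) <= u / 2 by rewrite ge_min lexx orbT.
    by lra.
have ha : r < N a / D a.
  by rewrite ltr_pdivlMr ?Dpos// -subr_gt0; apply: pos; rewrite a0.
have [|c /andP[? ?] ec] := mvt a (u / 2) a0 au; first exact: ltW.
by exists c => //; apply/andP; split; lra.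
Qed.

(** As in [single_drop_primitive], applied to N / D, which has the sign of N; [quotient_crossing]
    replaces the mean value theorem on the interval that touches 0. *)
Lemma single_drop_quotient N D e : N 0 = 0 -> D 0 = 0 ->
  has_deriv N 0 0 -> has_deriv D 0 1 ->
  (forall t, 0 < t -> 0 < D t) ->
  (forall t, 0 < t -> has_deriv (fun x => N x / D x) t (e t)) ->
  single_drop e -> single_drop N.
Proof.
move=> N0 D0 dN dD Dpos dh drop u v u0 uv Nu; have v0 : 0 < v by lra.
have [c /andP[c0 cu] ec] := quotient_crossing N D e N0 D0 dN dD Dpos dh u u0 Nu.
have [|d /andP[ud dv] E] := has_deriv_mvt (fun x => N x / D x) e u v uv.
  by move=> t /andP[ut _]; apply: dh; lra.
have : e d * (v - u) < 0 by rewrite pmulr_llt0 ?subr_gt0// (drop c)//; lra.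
rewrite -E => hv.
have hu : N u / D u <= 0 by rewrite pmulr_lle0 ?invr_gt0 ?Dpos.
by rewrite -(@pmulr_llt0 _ (D v)^-1) ?invr_gt0 ?Dpos//; lra.
Qed.

Lemma pos_quotient N D e : N 0 = 0 -> D 0 = 0 ->
  has_deriv N 0 0 -> has_deriv D 0 1 ->
  (forall t, 0 < t -> 0 < D t) ->
  (forall t, 0 < t -> has_deriv (fun x => N x / D x) t (e t)) ->
  (forall t, 0 < t -> 0 < e t) -> forall t, 0 < t -> 0 < N t.
Proof.
move=> N0 D0 dN dD Dpos dh epos t t0; rewrite ltNge; apply/negP => Nt.
have [c /andP[c0 _]] := quotient_crossing N D e N0 D0 dN dD Dpos dh t t0 Nt.
by rewrite leNgt epos.
Qed.

(** If g t <= 0, then g1 is nonpositive somewhere before t, so g decreases strictly after t. It then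
    stays below the negative value g (t + 1), against its behaviour at infinity. *)
Lemma pos_of_vanishing_at_infinity g g1 :
  (forall t, 0 <= t -> has_deriv g t (g1 t)) -> g 0 = 0 -> single_drop g1 ->
  (forall r, 0 < r -> exists A, forall t, A < t -> - r < g t) ->
  forall t, 0 < t -> 0 < g t.
Proof.
move=> dg g0 drop lim t t0; rewrite ltNge; apply/negP => gt0.
have [|c /andP[c0 ct] E] := has_deriv_mvt g g1 0 t t0.
  by move=> x /andP[x0 _]; exact: dg.
have g1c : g1 c <= 0 by rewrite -(pmulr_lle0 _ t0); lra.
have decr a b : t <= a -> a < b -> g b < g a.
  move=> ta ab; have [|d /andP[ad db] E'] := has_deriv_mvt g g1 a b ab.
    by move=> x /andP[ax _]; apply: dg; lra.
  have : g1 d * (b - a) < 0 by rewrite pmulr_llt0 ?subr_gt0// (drop c)//; lra.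
  lra.
have g1t : g (t + 1) < 0 by apply: (lt_le_trans (decr t (t + 1) _ _)); lra.
have [|A far] := lim (- g (t + 1)); first lra.
have lA : A <= Order.max A (t + 1) by rewrite le_max lexx.
have lt_ : t + 1 <= Order.max A (t + 1) by rewrite le_max lexx orbT.
set v := Order.max A (t + 1) + 1.
have : - - g (t + 1) < g v by apply: far; rewrite /v; lra.
have : g v < g (t + 1) by apply: decr; rewrite /v; lra.
lra.
Qed.

End SignPatterns.

(** * Combinations of hyperbolic sines and a Descartes-type rule *)

Section HyperbolicSums.
Context {R : realType}.
Implicit Types (l : seq (R * R)) (t u k : R).

Definition sinh u : R := (expR u - expR (- u)) / 2.
Definition cosh u : R := (expR u + expR (- u)) / 2.

Lemma sinh0 : sinh 0 = 0.
Proof. by rewrite /sinh oppr0; lra. Qed.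

Lemma cosh0 : cosh 0 = 1.
Proof. by rewrite /cosh oppr0 expR0; lra. Qed.

Lemma sinhN u : sinh (- u) = - sinh u.
Proof. by rewrite /sinh opprK; lra. Qed.

Lemma sinh_gt0 u : 0 < u -> 0 < sinh u.
Proof.
by move=> u0; rewrite divr_gt0// subr_gt0 ltr_expR; lra.
Qed.

Lemma cosh_gt0 u : 0 < cosh u.
Proof. by rewrite divr_gt0// addr_gt0 ?expR_gt0. Qed.

Lemma has_deriv_sinh f t c : has_deriv f t c ->
  has_deriv (fun x => sinh (f x)) t (cosh (f t) * c).
Proof. by move=> df; rewrite /sinh /cosh; derive_tac; field. Qed.

Lemma has_deriv_cosh f t c : has_deriv f t c ->
  has_deriv (fun x => cosh (f x)) t (sinh (f t) * c).
Proof. by move=> df; rewrite /sinh /cosh; derive_tac; field. Qed.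

Lemma has_deriv_ln_cosh f t c : has_deriv f t c ->
  has_deriv (fun x => ln (cosh (f x))) t (sinh (f t) / cosh (f t) * c).
Proof.
move=> df; apply: has_deriv_eq.
  by apply: has_deriv_ln; [exact: cosh_gt0|exact: has_deriv_cosh df].
by ring.
Qed.

(** The entries of [l] are pairs (coefficient, frequency), so that differentiation and the removal
    of a frequency act on lists. *)
Definition sinh_sum l t := \sum_(x <- l) x.1 * sinh (x.2 * t).
Definition cosh_sum l t := \sum_(x <- l) x.1 * cosh (x.2 * t).
Definition deriv_coefs l : seq (R * R) := [seq (x.1 * x.2, x.2) | x <- l].

Lemma sinh_sum0 l : sinh_sum l 0 = 0.
Proof. by rewrite /sinh_sum big1// => x _; rewrite mulr0 sinh0 mulr0. Qed.

Lemma has_deriv_sinh_sum l t :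
  has_deriv (sinh_sum l) t (cosh_sum (deriv_coefs l) t).
Proof.
rewrite /sinh_sum /cosh_sum /deriv_coefs; elim: l => [|x l IH].
  rewrite big_nil (_ : (fun _ => _) = fun=> 0); first exact: has_deriv_cst.
  by apply/funext => u; rewrite big_nil.
rewrite (_ : (fun _ => _) =
  fun u => x.1 * sinh (x.2 * u) + \sum_(y <- l) y.1 * sinh (y.2 * u)); last first.
  by apply/funext => u; rewrite big_cons.
apply: has_deriv_eq.
  apply: has_derivD IH; apply: has_derivM; first exact: has_deriv_cst.
  by apply: has_deriv_sinh; apply: has_derivM; [exact: has_deriv_cst|exact: has_deriv_id].
by rewrite /= big_cons/=; ring.
Qed.

Lemma has_deriv_cosh_sum l t :
  has_deriv (cosh_sum l) t (sinh_sum (deriv_coefs l) t).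
Proof.
rewrite /sinh_sum /cosh_sum /deriv_coefs; elim: l => [|x l IH].
  rewrite big_nil (_ : (fun _ => _) = fun=> 0); first exact: has_deriv_cst.
  by apply/funext => u; rewrite big_nil.
rewrite (_ : (fun _ => _) =
  fun u => x.1 * cosh (x.2 * u) + \sum_(y <- l) y.1 * cosh (y.2 * u)); last first.
  by apply/funext => u; rewrite big_cons.
apply: has_deriv_eq.
  apply: has_derivD IH; apply: has_derivM; first exact: has_deriv_cst.
  by apply: has_deriv_cosh; apply: has_derivM; [exact: has_deriv_cst|exact: has_deriv_id].
by rewrite /= big_cons/=; ring.
Qed.

Definition initial_slope l := \sum_(x <- l) x.1 * x.2.

Lemma cosh_sum0 l : cosh_sum (deriv_coefs l) 0 = initial_slope l.
Proof.
rewrite /cosh_sum big_map; apply: eq_bigr => x _ /=.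
by rewrite mulr0 cosh0 mulr1.
Qed.

(* The coefficients of f'' - k^2 f: the terms of frequency k disappear. *)
Definition kill k l : seq (R * R) := [seq (x.1 * (x.2 ^+ 2 - k ^+ 2), x.2) | x <- l].

Lemma sinh_sum_kill k l t : sinh_sum (kill k l) t =
  sinh_sum (deriv_coefs (deriv_coefs l)) t - k ^+ 2 * sinh_sum l t.
Proof.
rewrite /sinh_sum !big_map mulr_sumr -sumrB; apply: eq_bigr => x _ /=.
by ring.
Qed.

(** [upper] and [lower] invert the factorization f'' - k^2 f = (d/dt - k)(d/dt + k) f: each factor
    becomes a plain derivative after multiplication by an exponential. *)
Let upper k l t := expR (- k * t) * (cosh_sum (deriv_coefs l) t + k * sinh_sum l t).

Let has_deriv_upper k l t :
  has_deriv (upper k l) t (expR (- k * t) * sinh_sum (kill k l) t).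
Proof.
have dS := has_deriv_sinh_sum l t; have dC := has_deriv_cosh_sum (deriv_coefs l) t.
by rewrite /upper; derive_tac; rewrite sinh_sum_kill; ring.
Qed.

Let lower k l t := expR (k * t) * sinh_sum l t.

Let has_deriv_lower k l t :
  has_deriv (lower k l) t (expR (k * t) ^+ 2 * upper k l t).
Proof.
have dS := has_deriv_sinh_sum l t.
rewrite /lower /upper; derive_tac; rewrite mulNr expRN.
by have := expR_gt0 (k * t) => e0; field; rewrite gt_eqF.
Qed.

Let upper0 k l : upper k l 0 = initial_slope l.
Proof. by rewrite /upper cosh_sum0 sinh_sum0 !mulr0 expR0; ring. Qed.

Let lower0 k l : lower k l 0 = 0.
Proof. by rewrite /lower sinh_sum0 mulr0. Qed.

(** The pattern climbs from [kill k l] to [upper] and then to [lower], by two primitives whose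
    values at 0 are the slope and 0. The exponential weights are positive and preserve signs. *)
Lemma sinh_sum_drop k l : 0 <= initial_slope l ->
  single_drop (sinh_sum (kill k l)) -> single_drop (sinh_sum l).
Proof.
move=> slope drop.
apply: (single_drop_pmul (lower k l) _ (fun t => expR (- k * t))).
- by move=> t _; exact: expR_gt0.
- move=> t _; rewrite /lower mulNr expRN mulrA mulVf ?mul1r//.
  by rewrite gt_eqF ?expR_gt0.
apply: (single_drop_primitive _ _ (fun t _ => has_deriv_lower k l t)).
  by rewrite lower0.
apply: (single_drop_pmul (upper k l) _ (fun t => expR (k * t) ^+ 2)) => //.
  by move=> t _; rewrite exprn_gt0 ?expR_gt0.
apply: (single_drop_primitive _ _ (fun t _ => has_deriv_upper k l t)).
  by rewrite upper0.
apply: (single_drop_pmul _ _ (fun t => expR (- k * t))) drop => // t _.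
exact: expR_gt0.
Qed.

Lemma sinh_sum_pos k l : 0 <= initial_slope l ->
  (forall t, 0 < t -> 0 < sinh_sum (kill k l) t) ->
  forall t, 0 < t -> 0 < sinh_sum l t.
Proof.
move=> slope pos t t0; suff: 0 < lower k l t by rewrite pmulr_rgt0 ?expR_gt0.
apply: (pos_primitive _ _ (fun t _ => has_deriv_lower k l t)) t0 => [|{}t t0].
  by rewrite lower0.
rewrite mulr_gt0 ?exprn_gt0 ?expR_gt0//.
apply: (pos_primitive _ _ (fun t _ => has_deriv_upper k l t)) t0 => [|{}t t0].
  by rewrite upper0.
by rewrite mulr_gt0 ?expR_gt0 ?pos.
Qed.

(** Base case of the Descartes argument. If the slope at 0 is nonnegative, then b > 0 and removing
    [mu] leaves a single negative term. Otherwise removing [lam] from the opposite sum shows that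
    the sum is negative for all t > 0. *)
Lemma sinh_diff_drop (b c lam mu : R) : 0 < lam -> lam < mu -> 0 < c ->
  single_drop (sinh_sum [:: (b, lam); (- c, mu)]).
Proof.
move=> lam0 lm c0; have mu0 : 0 < mu by lra.
have sq : lam ^+ 2 < mu ^+ 2 by rewrite ltr_pXn2r ?nnegrE ?ltW.
have [s0|s0] := leP 0 (initial_slope [:: (b, lam); (- c, mu)]).
  apply: (sinh_sum_drop mu _ s0) => u v u0 uv _.
  move: s0; rewrite /initial_slope /sinh_sum !big_cons !big_nil/= => s0.
  have cm : 0 < c * mu by rewrite mulr_gt0.
  have b0 : 0 < b by rewrite -(pmulr_lgt0 _ lam0); lra.
  rewrite subrr mulr0 mul0r !addr0 pmulr_llt0 ?sinh_gt0 ?mulr_gt0//; last by lra.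
  by rewrite pmulr_rlt0//; lra.
have pos := @sinh_sum_pos lam [:: (- b, lam); (c, mu)].
move=> u v u0 uv _; have v0 : 0 < v by lra.
suff : 0 < sinh_sum [:: (- b, lam); (c, mu)] v.
  by rewrite /sinh_sum !big_cons !big_nil/=; lra.
apply: pos v0.
  by move: s0; rewrite /initial_slope !big_cons !big_nil/=; lra.
move=> t t0; rewrite /sinh_sum !big_cons !big_nil/= subrr mulr0 mul0r add0r addr0.
by rewrite mulr_gt0 ?sinh_gt0 ?mulr_gt0//; lra.
Qed.

End HyperbolicSums.

(** * Sign of the discriminant M *)

Section Discriminant.
Context {R : realType}.
Implicit Types p t : R.

Lemma ltr_sinh (u v : R) : u < v -> sinh u < sinh v.
Proof.
move=> uv; rewrite /sinh; have : expR u < expR v by rewrite ltr_expR.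
have : expR (- v) < expR (- u) by rewrite ltr_expR; lra.
lra.
Qed.

Definition discr p : seq (R * R) :=
  [:: (-1, 3 * p - 2); ((p - 1) ^+ 2, p + 2); (- 2 * (p - 2), p);
      (- (p ^+ 2 - 2), p - 2)].

Definition opp_coefs (l : seq (R * R)) : seq (R * R) := [seq (- x.1, x.2) | x <- l].

Lemma sinh_sum_opp l t : sinh_sum (opp_coefs l) t = - sinh_sum l t.
Proof.
by rewrite /sinh_sum big_map -sumrN; apply: eq_bigr => x _ /=; rewrite mulNr.
Qed.

Lemma discr_slope p : initial_slope (discr p) = 0.
Proof. by rewrite /initial_slope !big_cons big_nil/=; ring. Qed.

(** The result is independent of k: the slope of [discr p] vanishes, so only the sum of coefficients
    times cubed frequencies remains. *)
Lemma discr_slope_kill k p :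
  initial_slope (kill k (discr p)) = 8 * p * (p - 1) ^+ 2 * (p - 2).
Proof. by rewrite /initial_slope !big_cons big_nil/=; ring. Qed.

Lemma initial_slope_opp l : initial_slope (opp_coefs l) = - initial_slope l.
Proof.
by rewrite /initial_slope big_map -sumrN; apply: eq_bigr => x _ /=; rewrite mulNr.
Qed.

Lemma kill_opp k l : kill k (opp_coefs l) = opp_coefs (kill k l).
Proof.
by rewrite /kill /opp_coefs -!map_comp; apply: eq_map => x /=; rewrite mulNr.
Qed.

Lemma discr_drop_gt2 p : 2 < p -> single_drop (sinh_sum (discr p)).
Proof.
move=> p2; apply: (sinh_sum_drop (p - 2)); first by rewrite discr_slope.
apply: (sinh_sum_drop p).
  by rewrite discr_slope_kill !mulr_ge0//; lra.
(* The surviving frequencies satisfy p + 2 < 3 p - 2 because p > 2. *)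
set b := (p - 1) ^+ 2 * ((p + 2) ^+ 2 - (p - 2) ^+ 2) * ((p + 2) ^+ 2 - p ^+ 2).
set c := 2 * p * (4 * p - 4) * ((2 * p - 2) * (4 * p - 2)).
have -> : sinh_sum (kill p (kill (p - 2) (discr p))) =
          sinh_sum [:: (b, p + 2); (- c, 3 * p - 2)].
  apply/funext => t; rewrite /sinh_sum !big_cons !big_nil/= /b /c.
  by ring.
by apply: sinh_diff_drop; rewrite ?mulr_gt0//; lra.
Qed.

Lemma discr_drop_lt2 p : 0 < p < 2 -> p != 1 ->
  single_drop (sinh_sum (opp_coefs (discr p))).
Proof.
move=> /andP[p0 p2] p1.
apply: (sinh_sum_drop (3 * p - 2)).
  by rewrite initial_slope_opp discr_slope oppr0.
rewrite kill_opp; apply: (sinh_sum_drop p).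
  rewrite initial_slope_opp discr_slope_kill -mulrN.
  by rewrite mulr_ge0 ?(mulr_ge0 _ (sqr_ge0 _)) ?mulr_ge0//; lra.
(* Now 2 - p < p + 2 survive. Here b may have either sign, while c > 0 because p differs from 1. *)
set b := (2 - p ^+ 2) * ((p - 2) ^+ 2 - (3 * p - 2) ^+ 2) * ((p - 2) ^+ 2 - p ^+ 2).
set c := (p - 1) ^+ 2 * ((4 - 2 * p) * (4 * p) * (4 * p + 4)).
have -> : sinh_sum (kill p (opp_coefs (kill (3 * p - 2) (discr p)))) =
          sinh_sum [:: (b, 2 - p); (- c, p + 2)].
  apply/funext => t; rewrite /sinh_sum !big_cons !big_nil/= /b /c.
  have -> : sinh ((p - 2) * t) = - sinh ((2 - p) * t).
    by rewrite -sinhN; congr sinh; ring.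
  by ring.
apply: sinh_diff_drop; [lra|lra|].
rewrite mulr_gt0 ?exprn_even_gt0//= ?subr_eq0//.
by rewrite !mulr_gt0//; lra.
Qed.

Lemma discr_pos p t : p < 0 -> 0 < t -> 0 < sinh_sum (discr p) t.
Proof.
move=> p0; apply: (sinh_sum_pos (p + 2)); first by rewrite discr_slope.
apply: (sinh_sum_pos p).
  rewrite discr_slope_kill -mulrA -mulrNN mulr_ge0//; first by lra.
  by rewrite -mulrN mulr_ge0 ?sqr_ge0//; lra.
move=> {}t t0.
have A0 : 0 < sinh ((2 - p) * t) by rewrite sinh_gt0// mulr_gt0//; lra.
have AB : sinh ((2 - p) * t) < sinh ((2 - 3 * p) * t).
  by rewrite ltr_sinh// ltr_pM2r//; lra.
(* Up to a positive factor, sinh ((2 - p) t) has coefficient p^2 - 2, possibly negative. It is split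
   as - (2 - p)(1 - 2 p) + (3 p^2 - 5 p), and the negative part is absorbed by the term of larger
   frequency 2 - 3 p. *)
suff -> : sinh_sum (kill p (kill (p + 2) (discr p))) t =
   32 * (- p * (1 - p)) * ((2 - p) * (1 - 2 * p) *
     (sinh ((2 - 3 * p) * t) - sinh ((2 - p) * t)) +
     (3 * p ^+ 2 - 5 * p) * sinh ((2 - p) * t)).
  have c1 : 0 < - p * (1 - p) by rewrite mulr_gt0//; lra.
  have c2 : 0 < (2 - p) * (1 - 2 * p) by rewrite mulr_gt0//; lra.
  have c3 : 0 < 3 * p ^+ 2 - 5 * p by have := sqr_ge0 p; lra.
  apply: mulr_gt0; first exact: mulr_gt0.
  by rewrite addr_gt0 ?(mulr_gt0 c2) ?(mulr_gt0 c3) ?subr_gt0.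
rewrite /sinh_sum !big_cons !big_nil/=.
have -> : sinh ((p - 2) * t) = - sinh ((2 - p) * t).
  by rewrite -sinhN; congr sinh; ring.
have -> : sinh ((3 * p - 2) * t) = - sinh ((2 - 3 * p) * t).
  by rewrite -sinhN; congr sinh; ring.
by ring.
Qed.

End Discriminant.

(** * Sign of the logarithmic gap for the exponent 2 / p *)

Section Gap.
Context {R : realType}.
Implicit Types p t : R.

Definition lcosh p t := ln (cosh (p * t)) / p.

(* With a = e^t / (2 cosh t) this is the logarithm of the right-hand side of
   the inequality, see [rhs_gap]. *)
Definition gap p t := lcosh p t + (p - 1) * ln (cosh (lcosh p t)) - p * ln (cosh t).

Definition phi p t := sinh ((p - 1) * t) / (p - 1).
Definition psi p t := sinh ((p + 1) * t).
Definition xpow p t := expR (2 * lcosh p t).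
Definition slope_num p t := p * xpow p t * phi p t + phi p t - psi p t.

Lemma has_deriv_linear (k t : R) : has_deriv (fun x => k * x) t k.
Proof. by derive_tac; ring. Qed.

Lemma has_deriv_lcosh p t : p != 0 ->
  has_deriv (lcosh p) t (sinh (p * t) / cosh (p * t)).
Proof.
move=> p0; have d := has_deriv_ln_cosh _ _ _ (has_deriv_linear p t).
rewrite /lcosh; derive_tac; field.
by rewrite p0 gt_eqF ?cosh_gt0.
Qed.

Lemma has_deriv_xpow p t : p != 0 ->
  has_deriv (xpow p) t (2 * (sinh (p * t) / cosh (p * t)) * xpow p t).
Proof.
by move=> p0; have d := has_deriv_lcosh p t p0; rewrite /xpow; derive_tac; ring.
Qed.

Lemma has_deriv_phi p t : p != 1 -> has_deriv (phi p) t (cosh ((p - 1) * t)).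
Proof.
move=> p1; have d := has_deriv_sinh _ _ _ (has_deriv_linear (p - 1) t).
by rewrite /phi; derive_tac; field; rewrite subr_eq0.
Qed.

Lemma has_deriv_psi p t : has_deriv (psi p) t ((p + 1) * cosh ((p + 1) * t)).
Proof.
apply: has_deriv_eq (has_deriv_sinh _ _ _ (has_deriv_linear (p + 1) t)) _.
exact: mulrC.
Qed.

Lemma xpow_gt0 p t : 0 < xpow p t.
Proof. exact: expR_gt0. Qed.

Lemma phi_gt0 p t : p != 1 -> 0 < t -> 0 < phi p t.
Proof.
move=> p1 t0; rewrite /phi; have [lt1|gt1] : p < 1 \/ 1 < p.
    by apply/orP; rewrite -neq_lt.
  have -> : (p - 1) * t = - ((1 - p) * t) by ring.
  rewrite sinhN -[p - 1]opprB invrN mulrNN.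
  by rewrite divr_gt0 ?sinh_gt0 ?mulr_gt0//; lra.
by rewrite divr_gt0 ?sinh_gt0 ?mulr_gt0//; lra.
Qed.

Lemma phi0 p : phi p 0 = 0.
Proof. by rewrite /phi mulr0 sinh0 mul0r. Qed.

Lemma psi0 p : psi p 0 = 0.
Proof. by rewrite /psi mulr0 sinh0. Qed.

Lemma lcosh0 p : lcosh p 0 = 0.
Proof. by rewrite /lcosh mulr0 cosh0 ln1 mul0r. Qed.

Lemma xpow0 p : xpow p 0 = 1.
Proof. by rewrite /xpow lcosh0 mulr0 expR0. Qed.

Lemma gap0 p : gap p 0 = 0.
Proof. by rewrite /gap lcosh0 cosh0 ln1; ring. Qed.

(** The outer bracket is x phi^2 cosh (p t) times the derivative of p + (phi - psi) / (x phi), where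
    x' / x = 2 tanh (p t). The identity is rational in e^(p t) and e^t. *)
Lemma discrE p t : p != 1 -> sinh_sum (discr p) t =
  2 * (p - 1) ^+ 2 * (2 * sinh (p * t) * phi p t * (psi p t - phi p t) +
    cosh (p * t) * (cosh ((p - 1) * t) * psi p t -
                    phi p t * ((p + 1) * cosh ((p + 1) * t)))).
Proof.
move=> p1; rewrite /sinh_sum !big_cons big_nil/= /phi /psi /sinh /cosh !expRN.
have e3 : expR ((3 * p - 2) * t) = expR (p * t) ^+ 3 / expR t ^+ 2.
  by rewrite -!expRM_natl -expRB; congr expR; ring.
have e2 : expR ((p + 2) * t) = expR (p * t) * expR t ^+ 2.
  by rewrite -!expRM_natl -expRD; congr expR; ring.
have e2' : expR ((p - 2) * t) = expR (p * t) / expR t ^+ 2.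
  by rewrite -!expRM_natl -expRB; congr expR; ring.
have e1 : expR ((p + 1) * t) = expR (p * t) * expR t.
  by rewrite -expRD; congr expR; ring.
have e1' : expR ((p - 1) * t) = expR (p * t) / expR t.
  by rewrite -expRB; congr expR; ring.
rewrite e3 e2 e2' e1 e1'; field.
by rewrite subr_eq0 p1 !gt_eqF ?expR_gt0.
Qed.

Let has_deriv_ratio p t : p != 0 -> p != 1 -> 0 < t ->
  has_deriv (fun x => slope_num p x / (xpow p x * phi p x)) t
   ((2 * (p - 1) ^+ 2 * cosh (p * t) * xpow p t * phi p t ^+ 2)^-1 *
    sinh_sum (discr p) t).
Proof.
move=> p0 p1 t0.
have dx := has_deriv_xpow p t p0; have dphi := has_deriv_phi p t p1.
have dpsi := has_deriv_psi p t.
have x0 := xpow_gt0 p t; have f0 := phi_gt0 p t p1 t0; have c0 := cosh_gt0 (p * t).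
rewrite /slope_num; derive_tac; first by rewrite gt_eqF// mulr_gt0.
rewrite discrE//; field.
by rewrite subr_eq0 p1 !gt_eqF.
Qed.

Lemma slope_num0 p : slope_num p 0 = 0.
Proof. by rewrite /slope_num phi0 psi0; ring. Qed.

Lemma has_deriv_slope_num0 p : p != 0 -> p != 1 -> has_deriv (slope_num p) 0 0.
Proof.
move=> p0 p1; have dx := has_deriv_xpow p 0 p0; have dphi := has_deriv_phi p 0 p1.
have dpsi := has_deriv_psi p 0.
rewrite /slope_num; derive_tac.
by rewrite phi0 xpow0 !mulr0 cosh0; ring.
Qed.

Lemma has_deriv_slope_den0 p : p != 0 -> p != 1 ->
  has_deriv (fun t => xpow p t * phi p t) 0 1.
Proof.
move=> p0 p1; have dx := has_deriv_xpow p 0 p0; have dphi := has_deriv_phi p 0 p1.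
by derive_tac; rewrite phi0 xpow0 !mulr0 cosh0; ring.
Qed.

Lemma slope_weight_gt0 p t : p != 1 -> 0 < t ->
  0 < (2 * (p - 1) ^+ 2 * cosh (p * t) * xpow p t * phi p t ^+ 2)^-1.
Proof.
move=> p1 t0; rewrite invr_gt0; apply: mulr_gt0.
  apply: mulr_gt0 (xpow_gt0 _ _); apply: mulr_gt0 (cosh_gt0 _); apply: mulr_gt0 => //.
  by rewrite exprn_even_gt0//= subr_eq0.
by rewrite exprn_gt0// phi_gt0.
Qed.

Lemma slope_den_gt0 p t : p != 1 -> 0 < t -> 0 < xpow p t * phi p t.
Proof. by move=> p1 t0; rewrite mulr_gt0 ?xpow_gt0 ?phi_gt0. Qed.

Lemma slope_den0 p : xpow p 0 * phi p 0 = 0.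
Proof. by rewrite phi0 mulr0. Qed.

Lemma slope_num_drop p : 2 < p -> single_drop (slope_num p).
Proof.
move=> p2; have p0 : p != 0 by apply/eqP; lra.
have p1 : p != 1 by apply/eqP; lra.
apply: (single_drop_quotient _ _ _ (slope_num0 p) (slope_den0 p)
  (has_deriv_slope_num0 _ p0 p1) (has_deriv_slope_den0 _ p0 p1)
  (fun t => slope_den_gt0 p t p1) (fun t => has_deriv_ratio p t p0 p1)).
exact: (single_drop_pmul _ _ _ (fun t => slope_weight_gt0 p t p1) _
  (discr_drop_gt2 _ p2)).
Qed.

Lemma opp_slope_num_drop p : 0 < p < 2 -> p != 1 ->
  single_drop (fun t => - slope_num p t).
Proof.
move=> p02 p1; have p0 : p != 0 by apply/eqP; lra.
apply: (single_drop_quotient _ _ (fun t => - _) _ (slope_den0 p)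
  _ (has_deriv_slope_den0 _ p0 p1)
  (fun t => slope_den_gt0 p t p1)).
- by rewrite slope_num0 oppr0.
- have d := has_deriv_slope_num0 p p0 p1.
  by derive_tac; rewrite oppr0.
- move=> t t0; have d := has_deriv_ratio p t p0 p1 t0.
  rewrite (_ : (fun x => _) = fun x => - (slope_num p x / (xpow p x * phi p x))).
    exact: has_derivN d.
  by apply/funext => x; rewrite mulNr.
apply: (single_drop_pmul _ _ _ (fun t => slope_weight_gt0 p t p1) _
  (discr_drop_lt2 _ p02 p1)) => t t0.
by rewrite sinh_sum_opp mulrN.
Qed.

Lemma slope_num_gt0 p t : p < 0 -> 0 < t -> 0 < slope_num p t.
Proof.
move=> pN; have p0 : p != 0 by apply/eqP; lra.
have p1 : p != 1 by apply/eqP; lra.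
move: t; apply: (pos_quotient _ _ _ (slope_num0 p) (slope_den0 p)
  (has_deriv_slope_num0 _ p0 p1) (has_deriv_slope_den0 _ p0 p1)
  (fun t => slope_den_gt0 p t p1) (fun t => has_deriv_ratio p t p0 p1)).
by move=> t t0; rewrite mulr_gt0 ?slope_weight_gt0 ?discr_pos.
Qed.

Definition gap_weight p t := (cosh t * cosh (p * t) * (xpow p t + 1))^-1.

Lemma gap_weight_gt0 p t : 0 < gap_weight p t.
Proof.
rewrite invr_gt0; apply: mulr_gt0 (addr_gt0 (xpow_gt0 _ _) ltr01).
exact: mulr_gt0 (cosh_gt0 _) (cosh_gt0 _).
Qed.

(** The derivative is tanh (p t) (1 + (p - 1) tanh s) - p tanh t with tanh s = (x - 1) / (x + 1);
    [gap_weight] is the inverse of the common denominator. *)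
Lemma has_deriv_gap p t : p != 0 -> p != 1 ->
  has_deriv (gap p) t ((p - 1) * gap_weight p t * slope_num p t).
Proof.
move=> p0 p1; have d1 := has_deriv_lcosh p t p0.
have d2 := has_deriv_ln_cosh _ _ _ d1.
have d3 := has_deriv_ln_cosh _ _ _ (has_deriv_id t).
rewrite /gap; derive_tac; rewrite /gap_weight /slope_num.
have xE : xpow p t = expR (lcosh p t) ^+ 2 by rewrite -expRM_natl.
have -> : sinh (lcosh p t) / cosh (lcosh p t) = (xpow p t - 1) / (xpow p t + 1).
  rewrite xE /sinh /cosh expRN; field.
  have := exprn_gt0 2 (expR_gt0 (lcosh p t)) => e2.
  by rewrite !gt_eqF ?expR_gt0 ?addr_gt0//; lra.
have x0 := xpow_gt0 p t; move: (xpow p t) x0 => x x0.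
have e1 : expR ((p + 1) * t) = expR (p * t) * expR t.
  by rewrite -expRD; congr expR; ring.
have e1' : expR ((p - 1) * t) = expR (p * t) / expR t.
  by rewrite -expRB; congr expR; ring.
rewrite /phi /psi /sinh /cosh !expRN e1 e1'.
have X0 := expR_gt0 (p * t); have Y0 := expR_gt0 t.
move: (expR (p * t)) (expR t) X0 Y0 => X Y X0 Y0; field.
have X2 := exprn_gt0 2 X0; have Y2 := exprn_gt0 2 Y0.
by rewrite subr_eq0 p1 !gt_eqF//; lra.
Qed.

(** Separates the asymptote u - ln 2 at infinity from a remainder that tends to 0. *)
Lemma ln_coshE (u : R) : ln (cosh u) = u - ln 2 + ln (1 + expR (- (2 * u))).
Proof.
have e0 := expR_gt0 u; have n0 := expR_gt0 (- (2 * u)).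
rewrite -[X in X - _ + _]expRK -ln_div ?posrE// -lnM ?posrE ?divr_gt0//; last lra.
congr ln; rewrite /cosh (_ : - (2 * u) = - u - u); last by ring.
by rewrite expRD !expRN; field; rewrite gt_eqF.
Qed.

Lemma ln1_expN_small (r : R) : 0 < r ->
  (* With B = 1 / r, u > B gives e^(2u) >= 1 + 2u > 1 / r, and ln (1 + y) <= y concludes. *)
  exists2 B, 0 < B & forall u, B < u -> 0 <= ln (1 + expR (- (2 * u))) < r.
Proof.
move=> r0; exists r^-1; first by rewrite invr_gt0.
move=> u ru; have u0 : 0 < u by apply: lt_trans ru; rewrite invr_gt0.
have e0 := expR_gt0 (- (2 * u)); apply/andP; split; first by apply: ln_ge0; lra.
apply: (le_lt_trans (le_ln1Dx _)); first by lra.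
rewrite expRN invf_plt ?posrE ?expR_gt0//.
by have := expR_ge1Dx (2 * u); lra.
Qed.

Lemma gap_vanishes p : 0 < p ->
  forall r, 0 < r -> exists A, forall t, A < t -> - r < gap p t < r.
Proof.
(* The asymptotes cancel in the gap, leaving three remainders with weights 1, p - 1 and - p; 2 + 2 p
   bounds 1 + |p - 1| + p. *)
move=> p0 r r0; have r1 : 0 < r / (2 + 2 * p) by rewrite divr_gt0//; lra.
have [B B0 small] := ln1_expN_small _ r1.
have ln2 : 0 < ln (2 : R) by rewrite ln_gt0//; lra.
have l2p : 0 < ln (2 : R) / p by rewrite divr_gt0.
have Bp : 0 < B / p by rewrite divr_gt0.
(* This bound makes t, p t and s >= t - ln 2 / p all exceed B. *)
exists (B + B / p + ln 2 / p) => t Bt.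
set q := ln (1 + expR (- (2 * (p * t)))).
have sE : lcosh p t = t - ln 2 / p + q / p.
  by rewrite /lcosh ln_coshE -/q; field; rewrite gt_eqF.
have /andP[q0 qr] : 0 <= q < r / (2 + 2 * p).
  by apply: small; rewrite mulrC -ltr_pdivrMr//; lra.
have qp : 0 <= q / p by rewrite divr_ge0// ltW.
have /andP[v0 vr] := small t ltac:(lra).
have /andP[w0 wr] := small (lcosh p t) ltac:(lra).
have -> : gap p t = q + (p - 1) * ln (1 + expR (- (2 * lcosh p t)))
                    - p * ln (1 + expR (- (2 * t))).
  rewrite /gap [ln (cosh (lcosh p t))]ln_coshE [ln (cosh t)]ln_coshE {1 2}sE.
  by field; rewrite gt_eqF.
move: (ln (1 + expR (- (2 * lcosh p t)))) w0 wr => w w0 wr.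
move: (ln (1 + expR (- (2 * t)))) v0 vr => v v0 vr.
have rE : r = r / (2 + 2 * p) * (2 + 2 * p) by rewrite divfK// gt_eqF//; lra.
rewrite {1 2}rE; move: (r / _) r1 qr vr wr {rE small} => e e0 qe ve we.
by apply/andP; split; nra.
Qed.

Lemma gap_gt0 p t : 2 < p \/ 0 < p < 1 -> 0 < t -> 0 < gap p t.
Proof.
move=> hp; have p0 : p != 0 by apply/eqP; lra.
have p1 : p != 1 by apply/eqP; lra.
apply: (pos_of_vanishing_at_infinity _ _ (fun t _ => has_deriv_gap p t p0 p1)).
- exact: gap0.
- case: hp => hp.
    apply: single_drop_pmul (slope_num_drop _ hp) => [{}t _|//].
    by rewrite mulr_gt0 ?gap_weight_gt0//; lra.
  (* For 0 < p < 1 the factor p - 1 is negative, so its sign is moved onto [slope_num]. *)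
  apply: (single_drop_pmul _ _ (fun t => (1 - p) * gap_weight p t) _ _
    (opp_slope_num_drop _ _ p1)); last by lra.
  + by move=> {}t _; rewrite mulr_gt0 ?gap_weight_gt0//; lra.
  + by move=> {}t _; ring.
- move=> r r0; have [|A far] := gap_vanishes p _ _ r0; first lra.
  by exists A => {}t /far/andP[].
Qed.

Lemma gap_lt0 p t : p < 0 \/ 1 < p < 2 -> 0 < t -> gap p t < 0.
Proof.
move=> hp t0; have p0 : p != 0 by apply/eqP; lra.
have p1 : p != 1 by apply/eqP; lra.
rewrite -oppr_gt0.
have d u : 0 <= u -> has_deriv (fun x => - gap p x) u
    ((p - 1) * gap_weight p u * - slope_num p u).
  move=> _; have d := has_deriv_gap p u p0 p1.
  by derive_tac; ring.
case: hp => hp.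
  apply: (pos_primitive _ _ d) t0 => [|{}t t0]; first by rewrite gap0 oppr0.
  rewrite -mulrA nmulr_rgt0; last by lra.
  by rewrite pmulr_rlt0 ?gap_weight_gt0// oppr_lt0 slope_num_gt0.
apply: (pos_of_vanishing_at_infinity _ _ d _ _ _ _ t0).
- by rewrite gap0 oppr0.
- apply: (single_drop_pmul _ _ (fun t => (p - 1) * gap_weight p t) _ _
    (opp_slope_num_drop _ _ p1)) => //; last by lra.
  by move=> x _; rewrite mulr_gt0 ?gap_weight_gt0//; lra.
- move=> r r0; have [|A far] := gap_vanishes p _ _ r0; first lra.
  by exists A => x /far/andP[]; lra.
Qed.

End Gap.

(** * From the gap back to the inequality, and failure for other exponents *)

Section RightHandSide.
Context {R : realType}.
Implicit Types p q a t : R.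

Definition share t := expR t / (2 * cosh t).

Definition lrhs p q t := (p - 1) * ln (1 + expR (- q * ln (cosh (p * t)))) +
  ln (cosh (p * t)) - p * ln (cosh t) + (1 - p) * ln 2.

Lemma share_gt0 t : 0 < share t.
Proof. by rewrite divr_gt0 ?expR_gt0// mulr_gt0 ?cosh_gt0. Qed.

Lemma shareN t : share (- t) = 1 - share t.
Proof.
rewrite /share /cosh opprK; field.
by rewrite gt_eqF// addr_gt0 ?expR_gt0.
Qed.

Lemma share0 : share 0 = 1 / 2.
Proof. by rewrite /share cosh0 expR0 mulr1. Qed.

Lemma share_itv t : 0 < share t < 1.
Proof. by rewrite share_gt0/= -subr_gt0 -shareN share_gt0. Qed.

Lemma powR_share t k : share t `^ k = expR (k * (t - ln (2 * cosh t))).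
Proof.
rewrite /powR gt_eqF ?share_gt0//; congr (expR (_ * _)).
have c0 : 0 < 2 * cosh t by have := cosh_gt0 t; lra.
by rewrite /share ln_div ?posrE ?expR_gt0// expRK.
Qed.

Lemma powR_1share t k : (1 - share t) `^ k = expR (k * (- t - ln (2 * cosh t))).
Proof. by rewrite -shareN powR_share /cosh opprK [expR (- t) + _]addrC. Qed.

Lemma power_sum_share p t :
  power_sum p (share t) = 2 * cosh (p * t) * expR (- (p * ln (2 * cosh t))).
Proof.
rewrite /power_sum powR_share powR_1share !mulrBr !expRD mulrN.
by rewrite [cosh (p * t)]/cosh; field.
Qed.

Lemma ratioR_share p t : ratioR p (share t) = (cosh (p * t))^-1.
Proof.
rewrite /ratioR power_sum_share powR_share powR_1share -[2 * _ * _]mulrA -expRD.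
set l := ln (2 * cosh t).
rewrite (_ : p / 2 * (t - l) + p / 2 * (- t - l) = - (p * l)); last by field.
have e0 := expR_gt0 (- (p * l)); have c0 := cosh_gt0 (p * t).
by field; rewrite !gt_eqF.
Qed.

Lemma rhs_share p q t : rhs p q (share t) = expR (lrhs p q t).
Proof.
have c0 := cosh_gt0 t; have C0 := cosh_gt0 (p * t).
rewrite /rhs ratioR_share power_sum_share /powR.
rewrite [_^-1 == 0]gt_eqF ?invr_gt0// lnV ?posrE// mulrN -mulNr.
have w0 := expR_gt0 (- q * ln (cosh (p * t))).
rewrite gt_eqF; last by lra.
rewrite -[2 * cosh (p * t)]lnK ?posrE; last by lra.
rewrite -!expRD; congr expR; rewrite [ln (2 * cosh t)]lnM ?posrE//.
by rewrite [ln (2 * cosh (p * t))]lnM ?posrE// /lrhs; ring.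
Qed.

(** Since 1 + e^(-2s) = 2 e^(-s) cosh s, the terms in ln 2 cancel and p s - (p - 1) s = s
    remains. *)
Lemma lrhs_gap p t : p != 0 -> lrhs p (2 / p) t = gap p t.
Proof.
move=> p0; rewrite /lrhs /gap [ln (cosh (lcosh p t))]ln_coshE.
rewrite (_ : - (2 / p) * _ = - (2 * lcosh p t)); last by rewrite /lcosh; ring.
rewrite (_ : ln (cosh (p * t)) = p * lcosh p t); last by rewrite /lcosh; field.
by ring.
Qed.

Lemma share_surj a : 1 / 2 < a < 1 -> exists2 t, 0 < t & a = share t.
Proof.
move=> /andP[a2 a1]; have b0 : 0 < 1 - a by lra.
have r0 : 0 < a / (1 - a) by rewrite divr_gt0//; lra.
(* Half the log-odds of a, because share t / (1 - share t) = e^(2t). *)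
exists (ln (a / (1 - a)) / 2).
  by rewrite divr_gt0// ln_gt0// ltr_pdivlMr//; lra.
set t := _ / 2; have e0 := expR_gt0 t.
have e2 : expR t ^+ 2 = a / (1 - a).
  rewrite -expRM_natl (_ : 2 * t = ln (a / (1 - a))) ?lnK ?posrE//.
  by rewrite /t; field.
have -> : share t = expR t ^+ 2 / (expR t ^+ 2 + 1).
  rewrite /share /cosh expRN; field.
  have := exprn_gt0 2 e0; by rewrite !gt_eqF//=; lra.
by rewrite e2; field; rewrite !gt_eqF//; lra.
Qed.

Lemma rhs_sym p q a : rhs p q (1 - a) = rhs p q a.
Proof.
have psE : power_sum p (1 - a) = power_sum p a by rewrite /power_sum subKr addrC.
by rewrite /rhs /ratioR psE subKr [2 * (1 - a) `^ _ * _]mulrAC.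
Qed.

Lemma rhs_half p : p != 0 -> rhs p (2 / p) (1 / 2) = 1.
Proof. by move=> p0; rewrite -share0 rhs_share lrhs_gap// gap0 expR0. Qed.

Lemma rhs_gap p a : p != 0 -> 0 < a < 1 -> a != 1 / 2 ->
  exists2 t, 0 < t & rhs p (2 / p) a = expR (gap p t).
Proof.
move=> p0 /andP[a0 a1] a2.
have [lt2|gt2] : a < 1 / 2 \/ 1 / 2 < a by apply/orP; rewrite -neq_lt.
  have [|t t0 aE] := share_surj (1 - a); first by lra.
  by exists t; rewrite // -rhs_sym aE rhs_share lrhs_gap.
have [|t t0 aE] := share_surj a; first by lra.
by exists t; rewrite // aE rhs_share lrhs_gap.
Qed.

Lemma rhs_gt1 p a : 2 < p \/ 0 < p < 1 -> 0 < a < 1 -> a != 1 / 2 ->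
  1 < rhs p (2 / p) a.
Proof.
move=> hp a01 a2; have p0 : p != 0 by apply/eqP; lra.
have [t t0 ->] := rhs_gap p a p0 a01 a2.
by rewrite expR_gt1 gap_gt0.
Qed.

Lemma rhs_lt1 p a : p < 0 \/ 1 < p < 2 -> 0 < a < 1 -> a != 1 / 2 ->
  rhs p (2 / p) a < 1.
Proof.
move=> hp a01 a2; have p0 : p != 0 by apply/eqP; lra.
have [t t0 ->] := rhs_gap p a p0 a01 a2.
by rewrite expR_lt1 gap_lt0.
Qed.

Lemma rhs_at0 p : 0 < p -> rhs p (2 / p) 0 = 1.
Proof.
move=> p0; have hp : p != 0 by rewrite gt_eqF.
have h0 : p / 2 != 0 by rewrite gt_eqF// divr_gt0.
have q0 : 2 / p != 0 by rewrite gt_eqF// divr_gt0.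
rewrite /rhs /ratioR /power_sum subr0 powR1 (powR0 hp) (powR0 h0) mulr0 !mul0r.
by rewrite (powR0 q0) addr0 add0r powR1 mulr1.
Qed.

Lemma rhs_at1 p : 0 < p -> rhs p (2 / p) 1 = 1.
Proof. by move=> p0; rewrite -rhs_sym subrr rhs_at0. Qed.

Lemma rhs_exponent1 q a : 0 <= a <= 1 -> rhs 1 q a = 1.
Proof.
move=> /andP[a0 a1]; rewrite /rhs subrr powRr0 mul1r /power_sum !powRr1//; lra.
Qed.

(** Here (1 + R) (a^2 + (1 - a)^2) is the square of a + (1 - a). *)
Lemma rhs_exponent2 a : 0 <= a <= 1 -> rhs 2 (2 / 2) a = 1.
Proof.
move=> /andP[a0 a1]; rewrite /rhs /ratioR divff ?pnatr_eq0//.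
rewrite (_ : 2 - 1 = 1 :> R); last by ring.
have b0 : 0 <= 1 - a by lra.
rewrite [a `^ 1]powRr1// [(1 - a) `^ 1]powRr1//.
rewrite /power_sum !powR_mulrn//.
have s0 : 0 < a ^+ 2 + (1 - a) ^+ 2 by nra.
have r0 : 0 <= 2 * a * (1 - a) / (a ^+ 2 + (1 - a) ^+ 2).
  by apply: divr_ge0 (ltW s0); rewrite !mulr_ge0.
by rewrite !powRr1//; [field; rewrite gt_eqF|lra].
Qed.

Lemma pos_of_curvature (g g1 : R -> R) k : (forall t, has_deriv g t (g1 t)) ->
  g 0 = 0 -> g1 0 = 0 -> has_deriv g1 0 k -> 0 < k ->
  exists2 t, 0 < t & 0 < g t.
Proof.
move=> dg g0 g10 d2 k0; have [d d0 pos] := has_deriv_pos_right g1 k g10 d2 k0.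
have d20 : 0 < d / 2 by lra.
have [//|c /andP[c0 cd] E] := has_deriv_mvt g g1 0 (d / 2) d20.
exists (d / 2) => //.
have : 0 < g1 c * (d / 2 - 0) by rewrite mulr_gt0 ?subr0//; apply: pos; lra.
lra.
Qed.

Definition lrhs1 p q t := let w := expR (- q * ln (cosh (p * t))) in
  p * ((1 - (p - 1) * q * (w / (1 + w))) * (sinh (p * t) / cosh (p * t)) -
       sinh t / cosh t).

Lemma has_deriv_lrhs p q t : has_deriv (lrhs p q) t (lrhs1 p q t).
Proof.
have d1 := has_deriv_ln_cosh _ _ _ (has_deriv_linear p t).
have d2 := has_deriv_ln_cosh _ _ _ (has_deriv_id t).
have w0 := expR_gt0 (- q * ln (cosh (p * t))).
rewrite /lrhs; derive_tac; first by lra.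
rewrite /lrhs1/=; move: (expR _) w0 => w w0.
by field; rewrite !gt_eqF ?cosh_gt0//; lra.
Qed.

(** At 0 one has w = 1 and both quotients sinh / cosh vanish, so only their derivatives p and 1
    contribute: p ((1 - (p - 1) q / 2) p - 1). *)
Lemma has_deriv_lrhs1 p q :
  has_deriv (lrhs1 p q) 0 (p * (p - 1) * (2 - p * q) / 2).
Proof.
have d1 := has_deriv_ln_cosh _ _ _ (has_deriv_linear p 0).
have d2 := has_deriv_sinh _ _ _ (has_deriv_linear p 0).
have d3 := has_deriv_cosh _ _ _ (has_deriv_linear p 0).
have d4 := has_deriv_sinh _ _ _ (has_deriv_id (0 : R)).
have d5 := has_deriv_cosh _ _ _ (has_deriv_id (0 : R)).
have w0 := expR_gt0 (- q * ln (cosh (p * 0))).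
rewrite /lrhs1; derive_tac; rewrite ?gt_eqF ?cosh_gt0//; first by lra.
by rewrite !mulr0 sinh0 cosh0 ln1 mulr0 expR0; field.
Qed.

Lemma lrhs0 p q : lrhs p q 0 = 0.
Proof. by rewrite /lrhs mulr0 cosh0 ln1 mulr0 expR0; ring. Qed.

Lemma lrhs10 p q : lrhs1 p q 0 = 0.
Proof. by rewrite /lrhs1/= mulr0 sinh0; ring. Qed.

Lemma admissible_share p t : admissible p (share t).
Proof.
by have /andP[s0 s1] := share_itv t; split=> [|_]; rewrite ?s0 ?s1// !ltW.
Qed.

Lemma rhs_gt1_exists p q : 0 < p * (p - 1) * (2 - p * q) ->
  exists2 a, admissible p a & 1 < rhs p q a.
Proof.
move=> k0; have [|t t0 gt0] := pos_of_curvature _ _ _ (has_deriv_lrhs p q)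
  (lrhs0 p q) (lrhs10 p q) (has_deriv_lrhs1 p q); first by lra.
exists (share t); first exact: admissible_share.
by rewrite rhs_share expR_gt1.
Qed.

Lemma rhs_lt1_exists p q : p * (p - 1) * (2 - p * q) < 0 ->
  exists2 a, admissible p a & rhs p q a < 1.
Proof.
move=> k0.
have [||||t t0 gt0] := pos_of_curvature _ _ (- (p * (p - 1) * (2 - p * q) / 2))
  (fun t => has_derivN _ _ _ (has_deriv_lrhs p q t)).
- by rewrite lrhs0 oppr0.
- by rewrite lrhs10 oppr0.
- exact: has_derivN (has_deriv_lrhs1 p q).
- lra.
exists (share t); first exact: admissible_share.
by rewrite rhs_share expR_lt1 -oppr_gt0.
Qed.

End RightHandSide.

(* In the fourth clause of the second block p = 1 is excluded: there
   rhs 1 q a = 1 for all q and admissible a, so no inequality can fail. *)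
Theorem theorem1p3 (R : realType) :
  [/\ (forall p : R, (0 < p <= 1 \/ 2 <= p) ->
         forall a : R, admissible p a -> 1 <= rhs p (2 / p) a)
      /\
      (forall p : R, (p < 0 \/ 1 < p < 2) ->
         forall a : R, admissible p a -> 1 >= rhs p (2 / p) a),
      [/\ (forall p q : R, 2 < p -> q > 2 / p ->
             ~ (forall a : R, admissible p a -> 1 <= rhs p q a)),
          (forall p q : R, 0 < p < 1 -> q < 2 / p ->
             ~ (forall a : R, admissible p a -> 1 <= rhs p q a)),
          (forall p q : R, p < 0 -> q > 2 / p ->
             ~ (forall a : R, admissible p a -> 1 >= rhs p q a))
        & (forall p q : R, 1 < p <= 2 -> q < 2 / p ->
             ~ (forall a : R, admissible p a -> 1 >= rhs p q a))]
    & (forall p : R, 0 < p -> p <> 1 -> p <> 2 ->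
         forall a : R, admissible p a ->
           (1 = rhs p (2 / p) a <-> a = 0 \/ a = 1 / 2 \/ a = 1))
      /\
      (forall p : R, p < 0 ->
         forall a : R, admissible p a ->
           (1 = rhs p (2 / p) a <-> a = 1 / 2))].
Proof.
(* Separates the equality points, with 0 and 1 only for p > 0, from the points where the strict
   inequalities apply. *)
have cases (p a : R) : admissible p a -> p != 0 ->
    (rhs p (2 / p) a = 1 /\ (a = 0 /\ 0 < p \/ a = 1 / 2 \/ a = 1 /\ 0 < p)) \/
    (0 < a < 1 /\ a != 1 / 2).
  move=> [/andP[a0 a1] aN] p0.
  have [->|ah] := eqVneq a (1 / 2); first by left; rewrite rhs_half//; auto.
  have [pneg|ppos] := ltP p 0; first by right; split; rewrite ?aN.
  have p_gt0 : 0 < p by rewrite lt_def p0.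
  have [->|an0] := eqVneq a 0; first by left; rewrite rhs_at0//; auto.
  have [->|an1] := eqVneq a 1; first by left; rewrite rhs_at1//; auto.
  by right; rewrite !lt_def an0 a0 eq_sym an1 a1.
split.
- split=> p hp a adm.
    have p0 : p != 0 by apply/eqP; lra.
    have [->|p1] := eqVneq p 1; first by rewrite rhs_exponent1//; case: adm.
    have [->|p2] := eqVneq p 2; first by rewrite rhs_exponent2//; case: adm.
    have [[-> _]//|[a01 ah]] := cases p a adm p0.
    apply/ltW/rhs_gt1 => //.
    by move/eqP: p1 => p1; move/eqP: p2 => p2; lra.
  have p0 : p != 0 by apply/eqP; lra.
  have [[-> _]//|[a01 ah]] := cases p a adm p0.
  exact/ltW/rhs_lt1.
(* In each clause the position of q relative to 2 / p fixes the sign of p (p - 1) (2 - p q), hence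
   the side of 1 reached near a = 1/2. *)
- split=> p q hp hq all_a.
  + have : 2 < q * p by rewrite -ltr_pdivrMr//; lra.
    move=> pq; have [|a /all_a] := rhs_lt1_exists p q; last by rewrite leNgt => /negP.
    by rewrite pmulr_rlt0 ?mulr_gt0//; lra.
  + have : q * p < 2 by rewrite -ltr_pdivlMr//; lra.
    move=> pq; have [|a /all_a] := rhs_lt1_exists p q; last by rewrite leNgt => /negP.
    by rewrite pmulr_llt0 ?pmulr_rlt0//; lra.
  (* Multiplying by p < 0 reverses q > 2 / p. *)
  + have : q * p < 2 by rewrite -ltr_ndivrMr.
    move=> pq; have [|a /all_a] := rhs_gt1_exists p q; last by rewrite leNgt => /negP.
    by rewrite pmulr_lgt0 ?nmulr_rgt0//; lra.
  + have : q * p < 2 by rewrite -ltr_pdivlMr//; lra.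
    move=> pq; have [|a /all_a] := rhs_gt1_exists p q; last by rewrite leNgt => /negP.
    by rewrite !mulr_gt0//; lra.
- split.
    move=> p p_gt0 p1 p2 a adm; have p0 : p != 0 by rewrite gt_eqF.
    split=> [rhs1|]; last first.
      by move=> [->|[->|->]]; rewrite ?rhs_at0 ?rhs_half ?rhs_at1.
    have [[_ [[->]|[->|[->]]]]|[a01 ah]] := cases p a adm p0; [tauto..|].
    have [p12|p12] : (2 < p \/ 0 < p < 1) \/ (p < 0 \/ 1 < p < 2) by lra.
      by have := rhs_gt1 p a p12 a01 ah; rewrite -rhs1 ltxx.
    by have := rhs_lt1 p a p12 a01 ah; rewrite -rhs1 ltxx.
  move=> p pN a adm; have p0 : p != 0 by rewrite lt_eqF.
  split=> [rhs1|->]; last by rewrite rhs_half.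
  have [[_ h]|[a01 ah]] := cases p a adm p0; first by case: h => [[_]|[|[_]]]//; lra.
  by have := rhs_lt1 p a (or_introl pN) a01 ah; rewrite -rhs1 ltxx.
Qed.
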